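(* Let $\mathcal{F}\colon \mathbf{C} \to \mathbf{D}$ be a faithful functor and suppose that $\mathbf{C}$ has $\mathcal{F}$-free objects. Then every $\mathbf{C}$-object $K$ is realizable as an $\mathcal{F}$-quotient of an $\mathcal{F}$-free object. That is, for every $K \in \operatorname{Obj}(\mathbf{C})$ there are a pair $(A,i)$ which is $\mathcal{F}$-free over some $X \in \operatorname{Obj}(\mathbf{D})$, and an $\mathcal{F}$-epimorphism $\varphi$ with source $A$, such that $K = A/\varphi$.
   Context: Let $\mathcal{F}\colon \mathbf{C} \to \mathbf{D}$ be a faithful functor. A morphism $f$ of $\mathbf{C}$ is an $\mathcal{F}$-epimorphism if $\mathcal{F}(f)$ is an epimorphism in $\mathbf{D}$. For an $\mathcal{F}$-epimorphism $f\colon A \to B$, the target object $B$ is denoted $A/f$. Let $X \in \operatorname{Obj}(\mathbf{D})$, $A \in \operatorname{Obj}(\mathbf{C})$ and let $i\colon X \to \mathcal{F}(A)$ be a monomorphism in $\mathbf{D}$. The pair $(A,i)$ is $\mathcal{F}$-free over $X$ if for every $B \in \operatorname{Obj}(\mathbf{C})$ and every morphism $f\colon X \to \mathcal{F}(B)$ in $\mathbf{D}$ there is a unique morphism $\varphi\colon A \to B$ in $\mathbf{C}$ such that $\mathcal{F}(\varphi) \circ i = f$. The category $\mathbf{C}$ has $\mathcal{F}$-free objects if for every $X \in \operatorname{Obj}(\mathbf{D})$ there is a pair $(A,i)$ which is $\mathcal{F}$-free over $X$. *)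

(* Defs.v *)
Set Implicit Arguments.
Unset Strict Implicit.
Unset Printing Implicit Defensive.

Declare Scope cat_scope.
Delimit Scope cat_scope with cat.

(* Morphisms are compared with Leibniz equality. [comp g f] is "g after f". *)
Record Category : Type := MkCategory {
  Obj :> Type;
  Hom : Obj -> Obj -> Type;
  idm : forall A : Obj, Hom A A;
  comp : forall A B C : Obj, Hom B C -> Hom A B -> Hom A C;
  comp_id_l : forall (A B : Obj) (f : Hom A B), comp (idm B) f = f;
  comp_id_r : forall (A B : Obj) (f : Hom A B), comp f (idm A) = f;
  comp_assoc : forall (A B C D : Obj)
      (h : Hom C D) (g : Hom B C) (f : Hom A B),
    comp h (comp g f) = comp (comp h g) f
}.

Arguments Hom {_} _ _.
Arguments idm {_} _.
Arguments comp {_ _ _ _} _ _.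

Notation "A ~> B" := (Hom A B) (at level 90, no associativity) : cat_scope.
Notation "g ∘ f" := (comp g f) (at level 40, left associativity) : cat_scope.

Local Open Scope cat_scope.

Record Functor (C D : Category) : Type := MkFunctor {
  fobj :> C -> D;
  fmap : forall A B : C, (A ~> B) -> (fobj A ~> fobj B);
  fmap_id : forall A : C, fmap (idm A) = idm (fobj A);
  fmap_comp : forall (A B E : C) (g : B ~> E) (f : A ~> B),
    fmap (g ∘ f) = fmap g ∘ fmap f
}.

Arguments fmap {_ _} _ {_ _} _.

Definition faithful (C D : Category) (F : Functor C D) : Prop :=
  forall (A B : C) (f g : A ~> B), fmap F f = fmap F g -> f = g.

Definition mono (C : Category) (A B : C) (f : A ~> B) : Prop :=
  forall (Z : C) (g h : Z ~> A), f ∘ g = f ∘ h -> g = h.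

Definition epi (C : Category) (A B : C) (f : A ~> B) : Prop :=
  forall (Z : C) (g h : B ~> Z), g ∘ f = h ∘ f -> g = h.

Definition F_epi (C D : Category) (F : Functor C D) (A B : C) (f : A ~> B)
  : Prop := epi (fmap F f).

(* The object written A/f: by definition, the target of the F-epimorphism f. *)
Definition F_quotient (C D : Category) (F : Functor C D) (A B : C)
    (f : A ~> B) (_ : F_epi F f) : C := B.

Definition F_free (C D : Category) (F : Functor C D) (X : D) (A : C)
    (i : X ~> F A) : Prop :=
  mono i /\
  forall (B : C) (f : X ~> F B), exists! phi : A ~> B, fmap F phi ∘ i = f.

Definition has_F_free_objects (C D : Category) (F : Functor C D) : Prop :=
  forall X : D, exists (A : C) (i : X ~> F A), F_free i.

(* Main.v *)
Require Import Defs.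

Local Open Scope cat_scope.

(** Every [K] is a quotient of the free object on its own image [F K]: freeness extends the identity
    of [F K] to [phi : A ~> K], so [fmap F phi] has the section [i] and is epi by [split_epi]. *)

Lemma split_epi (C : Category) (A B : C) (f : A ~> B) (s : B ~> A) :
  f ∘ s = idm B -> epi f.
Proof.
  intros Hs Z g h Hgh.
  (* Cancel [f] through its section: [g = (g ∘ f) ∘ s = (h ∘ f) ∘ s = h]. *)
  rewrite <- (comp_id_r g), <- (comp_id_r h), <- Hs, !comp_assoc, Hgh.
  reflexivity.
Qed.

Theorem proposition2p11 (C D : Category) (F : Functor C D)
    (hF : faithful F) (hfree : has_F_free_objects F) (K : C) :
  exists (X : D) (A : C) (i : X ~> F A),
    F_free i /\
    exists (B : C) (phi : A ~> B) (hphi : F_epi F phi),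
      K = F_quotient hphi.
Proof.
  (* Over X = F K, the identity of F K extends to phi with F phi ∘ i = id. *)
  destruct (hfree (F K)) as [A [i Hi]].
  exists (F K), A, i; split; [exact Hi |].
  destruct (proj2 Hi K (idm (F K))) as [phi [Hphi _]].
  exists K, phi, (split_epi _ _ _ _ _ Hphi).
  (* [F_quotient] unfolds to the target of [phi], which is [K] itself. *)
  reflexivity.
Qed.
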